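(* Let $X$ be a fixed multigraph with $p$ vertices. There is a constant $C_X$ such that every $X$-topological-minor-free graph $G$ of treewidth $k\ge2$ satisfies $\mathrm{tpw}_p(G)\le C_X\,k^2\log k$.
   Context: Graphs are finite, simple and undirected (the excluded $X$ may have parallel edges); $\mathrm{tw}$ denotes treewidth. A graph $G$ is $X$-topological-minor-free if no subgraph of $G$ is isomorphic to a subdivision of $X$, where a subdivision replaces each edge by a path between its endpoints, these paths being internally disjoint from each other and from the vertex set of $X$ (so parallel edges of $X$ become internally disjoint paths, at most one of which can have no internal vertex). For graphs $G,H$, an $H$-partition of $G$ is a partition $(V_x : x\in V(H))$ of $V(G)$ such that for every edge $vw$ of $G$ with $v\in V_x$, $w\in V_y$, either $x=y$ or $xy\in E(H)$; its width is $\max_x|V_x|$. $\mathrm{tpw}_c(G)$ is the minimum width of an $H$-partition of $G$ over all graphs $H$ with $\mathrm{tw}(H)\le c$. *)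

(* Defs.v *)
From mathcomp Require Import all_boot.
From Stdlib Require Import Reals.

Set Implicit Arguments.
Unset Strict Implicit.
Unset Printing Implicit Defensive.

Definition simple_graph (T : finType) (adj : rel T) : Prop :=
  symmetric adj /\ irreflexive adj.

Definition is_tree (I : finType) (tr : rel I) : Prop :=
  simple_graph tr /\ 0 < #|I| /\
  (forall i j : I, connect tr i j) /\
  (forall s : seq I, 3 <= size s -> uniq s -> ~~ cycle tr s).

Definition tree_decomposition (T : finType) (adj : rel T)
    (I : finType) (tr : rel I) (B : I -> {set T}) : Prop :=
  is_tree tr /\
  (forall v : T, exists i : I, v \in B i) /\
  (forall v w : T, adj v w -> exists i : I, (v \in B i) && (w \in B i)) /\
  (forall (v : T) (i j : I), v \in B i -> v \in B j ->
     connect [rel a b | [&& tr a b, v \in B a & v \in B b]] i j).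

Definition tw_le (T : finType) (adj : rel T) (k : nat) : Prop :=
  exists (I : finType) (tr : rel I) (B : I -> {set T}),
    tree_decomposition adj tr B /\ forall i : I, #|B i| <= k.+1.

Definition treewidth_is (T : finType) (adj : rel T) (k : nat) : Prop :=
  tw_le adj k /\ forall j, tw_le adj j -> k <= j.

Definition loopless_multigraph (p : nat) (E : finType) (src tgt : E -> 'I_p)
  : Prop := forall e : E, src e != tgt e.

(* G contains a subdivision of X as a subgraph: injective branch map phi,
   and for each edge e of X a path of G from phi (src e) to phi (tgt e)
   with internal vertex sequence int e; internal vertices avoid the branch
   vertices and the internal vertices of the other paths; two parallel
   edges of X cannot both be realised by the same single edge of G. *)
Definition has_topological_minor (T : finType) (adj : rel T)
    (p : nat) (E : finType) (src tgt : E -> 'I_p) : Prop :=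
  exists (phi : 'I_p -> T) (int : E -> seq T),
    injective phi /\
    (forall e : E,
       path adj (phi (src e)) (rcons (int e) (phi (tgt e))) /\
       uniq (phi (src e) :: rcons (int e) (phi (tgt e)))) /\
    (forall (e : E) (v : T), v \in int e -> forall x : 'I_p, v != phi x) /\
    (forall (e e' : E), e != e' ->
       (forall v : T, v \in int e -> v \notin int e') /\
       (int e = [::] -> int e' = [::] ->
          [set src e; tgt e] != [set src e'; tgt e'])).

Definition topological_minor_free (T : finType) (adj : rel T)
    (p : nat) (E : finType) (src tgt : E -> 'I_p) : Prop :=
  ~ has_topological_minor adj src tgt.

Definition H_partition (T : finType) (adj : rel T)
    (U : finType) (h : rel U) (f : T -> U) : Prop :=
  forall v w : T, adj v w -> f v = f w \/ h (f v) (f w).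

Definition partition_width (T U : finType) (f : T -> U) (w : nat) : Prop :=
  forall x : U, #|[set v | f v == x]| <= w.

Definition tpw_le (c : nat) (T : finType) (adj : rel T) (w : nat) : Prop :=
  exists (U : finType) (h : rel U) (f : T -> U),
    simple_graph h /\ tw_le h c /\ H_partition adj h f /\
    partition_width f w.

(* Main.v *)
Require Import Defs.
From mathcomp Require Import all_boot zify_ssreflect.
From Stdlib Require Import Reals Lra Lia.
(* Reimported after [Reals], which rebinds [m ^ n] on [nat] to [Nat.pow]. *)
From mathcomp Require Import ssrnat.

Set Implicit Arguments.
Unset Strict Implicit.
Unset Printing Implicit Defensive.

(* Fix a tree decomposition of [adj] with bags of size at most K. The parts are
   chosen one at a time; the invariant is that a connected set [D] of vertices
   outside the parts chosen so far has at most 4K neighbours in them, and that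
   these neighbours lie in at most p parts, all contained in one bag of the
   decomposition of the quotient. Inside a component [D] with attachments [S],
   the next part hits every connected subset having p neighbours in [S], and
   contains enough bags to cut every remaining connected set down to 4K
   attachments.

   A hitting set of size O(K^2) exists by the Erdos-Posa property of subtrees as
   soon as [D] has only O(|S|) disjoint connected subsets with p neighbours in
   [S]. To see this, let as many of them as possible realise distinct edges of a
   graph [a] on [S]. By Mader's argument [a] is sparse, hence has O(|S|) cliques;
   each member of the family left over sees a p-clique of [a], and |E|+1 members
   seeing the same p-clique would give the excluded topological minor. The bound
   obtained is O(k^2), without the logarithm. *)

(** * Connected sets, neighbourhoods and components *)

Section Connectivity.
Variables (T : finType) (adj : rel T).
Implicit Types (x y : T) (D L : {set T}).

Definition inside D x y := [&& adj x y, x \in D & y \in D].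

Definition conn D := [forall x in D, forall y in D, connect (inside D) x y].

Definition nbhd D := [set x | (x \notin D) && [exists y in D, adj x y]].

Lemma connP D :
  reflect {in D &, forall x y, connect (inside D) x y} (conn D).
Proof.
apply: (iffP forall_inP) => [H x y xD yD|H x xD].
  exact: (forall_inP (H x xD)).
by apply/forall_inP => y yD; apply: H.
Qed.

Lemma nbhdP x D :
  reflect (x \notin D /\ exists2 y, y \in D & adj x y) (x \in nbhd D).
Proof.
rewrite inE; apply: (iffP andP) => -[xD].
  by case/exists_inP => y yD xy; split => //; exists y.
by case=> y yD xy; split => //; apply/exists_inP; exists y.
Qed.

Lemma sub_inside D L : D \subset L -> subrel (inside D) (inside L).
Proof.
move=> /subsetP DL x y /and3P[xy xD yD].
by apply/and3P; split => //; apply: DL.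
Qed.

Lemma connect_inside D L x y :
  D \subset L -> connect (inside D) x y -> connect (inside L) x y.
Proof. by move=> DL; apply: connect_sub => u v /(sub_inside DL)/connect1. Qed.

Lemma connect_insideW D x y :
  x \in D -> connect (inside D) x y -> y \in D.
Proof.
move=> xD /connectP[s]; elim: s x xD => [|z s IH] x xD /=; first by move=> _ ->.
by case/andP => /and3P[_ _ zD] ps; apply: IH.
Qed.

Lemma conn_set1 x : conn [set x].
Proof. by apply/connP => y z /set1P -> /set1P ->; apply: connect0. Qed.

Hypothesis adj_sym : symmetric adj.

Lemma inside_sym D : symmetric (inside D).
Proof. by move=> x y; rewrite /inside adj_sym; case: adj => //=; rewrite andbC. Qed.

Lemma connect_inside_sym D x y :
  connect (inside D) x y = connect (inside D) y x.
Proof. exact/sym_connect_sym/inside_sym. Qed.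

Lemma conn_star D x :
  x \in D -> (forall y, y \in D -> connect (inside D) x y) -> conn D.
Proof.
move=> xD H; apply/connP => y z yD zD.
by apply: connect_trans (H z zD); rewrite connect_inside_sym H.
Qed.

Lemma conn_setU1 D x : conn D -> x \in nbhd D -> conn (x |: D).
Proof.
move=> /connP cD /nbhdP[_ [y yD xy]].
apply: (@conn_star _ x); first exact: setU11.
move=> z /setU1P[->|zD]; first exact: connect0.
apply: (@connect_trans _ _ y).
  by apply: connect1; rewrite /inside xy setU11 setU1r.
by apply: (connect_inside _ (cD _ _ yD zD)); apply: subsetUr.
Qed.

Definition component L x := [set y | connect (inside (~: L)) x y].

Lemma mem_component L x : x \in component L x.
Proof. by rewrite inE connect0. Qed.

Lemma component_sub L x : x \notin L -> [disjoint component L x & L].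
Proof.
move=> xL; rewrite disjoint_subset; apply/subsetP => y; rewrite inE.
by move=> /(connect_insideW _); rewrite !inE; apply.
Qed.

Lemma component_closed L x y z : x \notin L ->
  y \in component L x -> z \notin L -> adj y z -> z \in component L x.
Proof.
move=> xL yC zL yz; have := yC; rewrite !inE => /connect_trans; apply.
apply: connect1; rewrite /inside yz !inE zL andbT.
by apply/negP => yL; have := component_sub xL; move/disjointFr/(_ yC); rewrite yL.
Qed.

Lemma conn_component L x : x \notin L -> conn (component L x).
Proof.
move=> xL; apply: (@conn_star _ x); first exact: mem_component.
move=> y; rewrite inE => /connectP[s]; elim/last_ind: s y => [|s z IH] y /=.
  by move=> _ ->; apply: connect0.
rewrite rcons_path last_rcons => /andP[ps /and3P[lz l1 l2]] ->.
have lC : last x s \in component L x by rewrite inE; apply/connectP; exists s.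
apply: connect_trans (IH _ ps erefl) _; apply: connect1.
rewrite /inside lz lC /=; apply: component_closed lC _ lz => //.
by rewrite inE in l2.
Qed.

(** A connected set off [L] that meets the component stays in it; if it does not meet it, a
    neighbour in the component would pull a vertex of the set in by closure. *)
Lemma component_dichotomy L x D : x \notin L -> conn D -> [disjoint D & L] ->
  D \subset component L x \/
  [disjoint D & component L x] /\ [disjoint nbhd D & component L x].
Proof.
move=> xL cD DL; case: (boolP [disjoint D & component L x]) => dis; last first.
  left; have /pred0Pn[y /andP[/= yD yC]] := dis.
  apply/subsetP => z zD; move: yC; rewrite !inE => /connect_trans; apply.
  apply: connect_inside (connP _ cD _ _ yD zD).
  by rewrite -disjoints_subset.
right; split=> //; rewrite disjoint_subset; apply/subsetP => y.
case/nbhdP => _ [z zD yz]; apply/negP => yC.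
have := disjointFr dis zD; rewrite (component_closed xL yC _ yz) //.
by rewrite (disjointFr DL zD).
Qed.

End Connectivity.

(* A subdivision of [X] in which [link e] contains the internal vertices of the
   path for [e], and is never empty. *)
Record model (T : finType) (adj : rel T) (p : nat) (E : finType)
    (src tgt : E -> 'I_p) (J : {set E}) (Y : {set T})
    (phi : 'I_p -> T) (link : E -> {set T}) : Prop := Model {
  model_inj : injective phi;
  model_branch : forall x, phi x \in Y;
  model_sub : forall e, e \in J -> link e \subset Y;
  model_conn : forall e, e \in J -> conn adj (link e);
  model_src : forall e, e \in J -> phi (src e) \in nbhd adj (link e);
  model_tgt : forall e, e \in J -> phi (tgt e) \in nbhd adj (link e);
  model_avoid : forall e x, e \in J -> phi x \notin link e;
  model_disj : forall e e', e \in J -> e' \in J -> e != e' ->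
    [disjoint link e & link e'] }.

(** * Topological minors from models with connected links *)

Section TopologicalMinor.
Variables (T : finType) (adj : rel T) (p : nat) (E : finType).
Variables (src tgt : E -> 'I_p).
Hypothesis adj_sym : symmetric adj.
Hypothesis loopless : loopless_multigraph src tgt.

(** A path without repetition inside [D], from a neighbour of [x] to a neighbour of [y], is extended
    by the two ends; its first vertex makes the list nonempty. *)
Lemma link_path (D : {set T}) x y : conn adj D ->
  x \in nbhd adj D -> y \in nbhd adj D -> x != y ->
  exists s, [/\ path adj x (rcons s y), uniq (x :: rcons s y),
                {subset s <= D} & s != [::]].
Proof.
move=> /connP cD /nbhdP[xD [x' x'D xx']] /nbhdP[yD [y' y'D yy']] xy.
have /connectP[s0] := cD _ _ x'D y'D.
case/shortenP => s ps us _ ly.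
have sD : {subset x' :: s <= D}.
  elim: s x' x'D ps {us ly xx'} => [|u s IH] v vD /=; first by move=> _ z; rewrite inE => /eqP ->.
  case/andP => /and3P[_ _ uD] /(IH _ uD) H z; rewrite inE => /predU1P[-> //|].
  exact: H.
exists (x' :: s); split=> //.
  rewrite rcons_path /= xx' /= -ly [in X in _ && X]adj_sym yy' andbT.
  by apply: sub_path ps => u v /and3P[].
rewrite cons_uniq rcons_uniq us andbT mem_rcons inE (negPf xy) /=.
apply/andP; split; last by apply: contra yD => /sD.
by apply: contra xD => /sD.
Qed.

(** Disjoint links give disjoint paths. As all internal lists are nonempty, the condition on
    parallel edges holds vacuously. *)
Lemma model_topological_minor Y phi link :
  model adj src tgt [set: E] Y phi link -> has_topological_minor adj src tgt.
Proof.
case=> phiI _ _ lc ls lt la ld.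
have H e : exists s, [/\ path adj (phi (src e)) (rcons s (phi (tgt e))),
    uniq (phi (src e) :: rcons s (phi (tgt e))), {subset s <= link e} & s != [::]].
  apply: link_path; rewrite ?lc ?ls ?lt ?inE //.
  by rewrite (inj_eq phiI) loopless.
pose Q e s := [&& path adj (phi (src e)) (rcons s (phi (tgt e))),
    uniq (phi (src e) :: rcons s (phi (tgt e))), all (mem (link e)) s & s != [::]].
have {}H e : exists s, Q e s.
  by case: (H e) => s [h1 h2 /allP h3 h4]; exists s; apply/and4P.
exists phi, (fun e => xchoose (H e)); split=> //.
have /(_ _)/and4P K e := xchooseP (H e).
split; first by move=> e; case: (K e).
split=> [e v ve x|e e' ee'].
  case: (K e) => _ _ /allP/(_ _ ve) /= vl _.
  by apply: contraTneq vl => ->; apply: la; rewrite inE.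
split=> [v ve|e0]; last by case: (K e) => _ _ _; rewrite e0.
case: (K e) => _ _ /allP/(_ _ ve) /= vl _.
apply/negP => ve'; case: (K e') => _ _ /allP/(_ _ ve') /= vl' _.
by have := disjointFr (ld e e' (in_setT _) (in_setT _) ee') vl; rewrite vl'.
Qed.

End TopologicalMinor.

(** * Mader's argument: dense graphs contain models *)

Section Mader.
Variables (T : finType) (a : rel T).
Hypotheses (a_sym : symmetric a) (a_irr : irreflexive a).
Implicit Types (Y U : {set T}) (v w : T).

Definition degree Y v := #|[set w in Y | a v w]|.

(* Every edge inside [Y] is counted twice. *)
Definition dsum Y := \sum_(v in Y) degree Y v.

Lemma dsum_setD1 Y v : v \in Y -> dsum Y = dsum (Y :\ v) + 2 * degree Y v.
Proof.
move=> vY; rewrite /dsum (big_setD1 v) //= mul2n -addnn addnCA; congr (_ + _).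
rewrite (eq_bigr (fun u => degree (Y :\ v) u + a v u)); last first.
  move=> u uY; rewrite /degree (cardsD1 v) !inE vY /= addnC a_sym; congr (_ + _).
  by apply: eq_card => w; rewrite !inE andbA.
rewrite big_split /=; congr (_ + _); rewrite /degree -sum1_card.
rewrite [RHS](eq_bigl (fun w => (w \in Y :\ v) && a v w)); last first.
  by move=> w; rewrite !inE; case: eqP => [->|]; rewrite ?a_irr ?andbF.
by rewrite big_mkcondr; apply: eq_bigr => w _; case: (a v w).
Qed.

Lemma degree_le Y v : degree Y v <= #|Y|.
Proof. by apply/subset_leq_card/subsetP => w; rewrite inE => /andP[]. Qed.

Lemma dsum0 : dsum set0 = 0.
Proof. by rewrite /dsum big_set0. Qed.

(* A maximal connected [U] whose contraction keeps the edge density: each of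
   its neighbours [v] lies in many triangles with the contracted vertex, as
   otherwise [v] could be contracted into [U] as well. *)
Lemma dense_neighbourhood d Y : 0 < d -> Y != set0 -> 2 * d * #|Y| <= dsum Y ->
  exists U, [/\ U \subset Y, conn a U, nbhd a U :&: Y != set0 &
                d * #|nbhd a U :&: Y| <= dsum (nbhd a U :&: Y)].
Proof.
move=> d0; have [n] := ubnP #|Y|; elim: n Y => // n IH Y ltY Y0 hY.
(* Density after contracting [U]: the vertices of [Y :\: U] plus one more, whose degree is the
   number of neighbours of [U]. *)
pose P U := [&& U \subset Y, conn a U &
  2 * d * (#|Y :\: U|.+1) <= dsum (Y :\: U) + 2 * #|nbhd a U :&: Y|].
have [v0 v0Y] := set0Pn _ Y0.
have P0 : P [set v0].
  apply/and3P; split; rewrite ?sub1set ?conn_set1 //.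
  have -> : nbhd a [set v0] :&: Y = [set w in Y | a v0 w].
    apply/setP => w; rewrite !inE [RHS]andbC; congr (_ && _).
    apply/andP/idP => [[_ /exists_inP[y /set1P ->]]|]; first by rewrite a_sym.
    move=> vw; split; first by apply: contraTneq vw => ->; rewrite a_irr.
    by apply/exists_inP; exists v0; rewrite ?set11 // a_sym.
  by move: hY; rewrite (dsum_setD1 v0Y) (cardsD1 v0 Y) v0Y.
have [U /maxsetP[/and3P[UY cU hU] Umax] v0U] := maxset_exists P0.
rewrite sub1set in v0U.
(* If [U] has no neighbour in [Y], all the density sits in the smaller set [Y :\: U], and induction
   applies there. *)
case: (eqVneq (nbhd a U :&: Y) set0) => [N0|N0].
  rewrite N0 cards0 muln0 addn0 in hU.
  have [|||U' [U'Y cU' N'0 hU']] := IH (Y :\: U).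
  - have U0 : 0 < #|U| by rewrite card_gt0; apply/set0Pn; exists v0.
    by move: ltY; rewrite -(cardsID U Y) (setIidPr UY); lia.
  - by apply: contraTneq hU => ->; rewrite cards0 dsum0 -ltnNge muln1; lia.
  - by apply: leq_trans hU; rewrite leq_mul2l leqnSn orbT.
  have U'U : U' \subset Y by apply: subset_trans U'Y (subsetDl _ _).
  have eN : nbhd a U' :&: Y = nbhd a U' :&: (Y :\: U).
    apply/setP => w; rewrite !in_setI in_setD; case wN: (w \in nbhd a U') => //=.
    case wU: (w \in U) => //=; case wY: (w \in Y) => //.
    have /nbhdP[_ [y yU' wy]] := wN.
    have /andP[yU yY] : (y \notin U) && (y \in Y) by rewrite -in_setD (subsetP U'Y).
    have : y \in nbhd a U :&: Y.
      rewrite in_setI yY andbT; apply/nbhdP; split => //; exists w => //.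
      by rewrite a_sym.
    by rewrite N0 inE.
  by exists U'; rewrite eN.
exists U; split=> //; set N := nbhd a U :&: Y in N0 hU *.
rewrite mulnC -sum_nat_const; apply: leq_sum => v vN.
have [vU vY] : v \notin U /\ v \in Y.
  by move: vN; rewrite !inE => /andP[/andP[]].
have vW : v \in Y :\: U by rewrite inE vU.
have : ~~ P (v |: U).
  by apply: contra vU => PvU; rewrite -(Umax _ PvU) ?setU11 ?subsetUr.
rewrite /P subUset sub1set vY UY /= conn_setU1 //=; last first.
  by move: vN; rewrite inE => /andP[].
rewrite -ltnNge.
have -> : Y :\: (v |: U) = (Y :\: U) :\ v.
  by apply/setP => w; rewrite !inE; case: (w == v); case: (w \in U).
have eN : nbhd a (v |: U) :&: Y =
    (N :\ v) :|: ([set w in Y :\: U | a v w] :\: N).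
  apply/setP => w; rewrite !in_setU !in_setD in_set1 !inE.
  case wY : (w \in Y); last by rewrite !andbF.
  rewrite !andbT negb_or; case wU : (w \in U); first by rewrite /= ?andbF.
  case: (eqVneq w v) => [->|wv] /=; first by rewrite a_irr ?andbF.
  apply/exists_inP/orP => [[y /setU1P[->|yU] wy]|[]].
  - case: (boolP [exists y in U, a w y]) => [|_]; first by left.
    by right; rewrite a_sym wy.
  - by left; apply/exists_inP; exists y.
  - by case/exists_inP => y yU wy; exists y => //; rewrite setU1r.
  - by case/andP => _ vw; exists v; rewrite ?setU11 // a_sym.
(* Neighbours of [v] off [U] lie in [N] or become new neighbours of the contracted vertex.
   Contracting [v] thus loses one vertex and [1 + degree N v] edges, so a violated density forces
   [d <= degree N v]. *)
have dv : degree (Y :\: U) v = #|[set w in Y :\: U | a v w] :\: N| + degree N v.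
  rewrite /degree -(cardsID N) addnC; congr (_ + _).
  apply: eq_card => w; rewrite !inE; case: (w \in U) => /=; first by rewrite ?andbF.
  by rewrite andbC; case: (w \in Y); rewrite ?andbF ?andbT.
have -> : #|nbhd a (v |: U) :&: Y| =
    #|N :\ v| + #|[set w in Y :\: U | a v w] :\: N|.
  rewrite eN cardsU (_ : _ :&: _ = set0) ?cards0 ?subn0 //.
  by apply/setP => w; rewrite in_set0 in_setI !in_setD; case: (w \in N); rewrite ?andbF.
have eN1 : #|N| = #|N :\ v|.+1 by rewrite (cardsD1 v N) vN.
have eW1 : #|Y :\: U| = #|(Y :\: U) :\ v|.+1 by rewrite (cardsD1 v (Y :\: U)) vW.
have eW2 := dsum_setD1 vW.
move: hU; rewrite eW2 dv eN1 eW1; move: (#|_|) (#|_|) (#|_|) (dsum _) (degree _ _).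
by move=> A B C D F; rewrite !mulnS; move: (2 * d * A) => H; clear; lia.
Qed.

Variables (p : nat) (E : finType) (src tgt : E -> 'I_p).
Hypothesis p_gt0 : 0 < p.

(** Induction on [#|J|], each edge costing half the density: a dense neighbourhood of a connected
    [U] hosts the model for the other edges, and [U] itself links the ends of the removed edge. *)
Lemma mader (J : {set E}) Y : Y != set0 -> p * 2 ^ #|J|.+1 * #|Y| <= dsum Y ->
  exists phi link, model a src tgt J Y phi link.
Proof.
have [m mE] : exists m, #|J| = m by exists #|J|.
elim: m J Y mE => [|m IH] J Y mE Y0 hY.
  (* With no edge left, any [p] distinct vertices form a model; they exist because degrees in [Y]
     are at most [#|Y|]. *)
  have pY : p <= #|Y|.
    have : dsum Y <= #|Y| * #|Y|.
      by rewrite -sum_nat_const; apply: leq_sum => v _; apply: degree_le.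
    move/(leq_trans hY); rewrite leq_pmul2r ?card_gt0 // mE => /(leq_trans _); apply.
    by rewrite leq_pmulr.
  have J0 := cards0_eq mE.
  have [y0 y0Y] := set0Pn _ Y0.
  exists (fun x : 'I_p => nth y0 (enum Y) x), (fun _ => set0).
  have sY : size (enum Y) = #|Y| by rewrite cardE.
  split=> [x y /eqP|x|e|e|e|e|e|e e']; rewrite ?J0 ?inE //.
    have lt (z : 'I_p) : z < size (enum Y) by rewrite sY; apply: leq_trans pY.
    by rewrite (nth_uniq _ (lt x) (lt y) (enum_uniq _)) => /eqP/val_inj.
  by rewrite -mem_enum mem_nth // sY; apply: leq_trans pY.
have [e0 e0J] : exists e0, e0 \in J by apply/set0Pn; rewrite -card_gt0 mE.
have mJ : #|J :\ e0| = m by move: mE; rewrite (cardsD1 e0) e0J => -[].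
have [|||U [UY cU N0 hN]] := @dense_neighbourhood (p * 2 ^ m.+1) Y.
- by rewrite muln_gt0 p_gt0 expn_gt0.
- by [].
- by move: hY; rewrite mE expnS mulnCA.
have [|phi [link M]] := IH (J :\ e0) (nbhd a U :&: Y) mJ N0; first by rewrite mJ.
have NU (D : {set T}) : D \subset nbhd a U :&: Y -> [disjoint D & U].
  move=> DN; rewrite disjoint_subset; apply/subsetP => z /(subsetP DN).
  by rewrite !inE => /andP[/andP[]].
have NY : nbhd a U :&: Y \subset Y by apply: subsetIr.
have bN x : phi x \in nbhd a U.
  by have := model_branch M x; rewrite inE => /andP[].
have inJ e : e \in J -> e != e0 -> e \in J :\ e0 by move=> eJ ee; rewrite !inE ee.
exists phi, (fun e => if e == e0 then U else link e); split.
- exact: model_inj M.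
- by move=> x; apply: (subsetP NY); apply: model_branch M x.
- move=> e eJ; case: eqP => // /eqP ee.
  exact: subset_trans (model_sub M (inJ _ eJ ee)) NY.
- by move=> e eJ; case: eqP => // /eqP ee; apply/(model_conn M)/inJ.
- by move=> e eJ; case: eqP => [//|/eqP ee]; apply/(model_src M)/inJ.
- by move=> e eJ; case: eqP => [//|/eqP ee]; apply/(model_tgt M)/inJ.
- move=> e x eJ; case: eqP => [_|/eqP ee]; first by have /nbhdP[] := bN x.
  by apply/(model_avoid M)/inJ.
- move=> e e' eJ e'J ne.
  case: (eqVneq e e0) => [ee|ee]; case: (eqVneq e' e0) => [ee'|ee'].
  + by rewrite ee ee' eqxx in ne.
  + by rewrite disjoint_sym; apply/NU/(model_sub M)/inJ.
  + by apply/NU/(model_sub M)/inJ.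
  + by apply: (model_disj M) ne; apply: inJ.
Qed.

End Mader.

(** * Counting cliques in sparse graphs *)

Section Cliques.
Variables (T : finType) (a : rel T).

Definition clique (Q : {set T}) :=
  [forall x in Q, forall y in Q, (x != y) ==> a x y].

Lemma clique_sub (Q Q' : {set T}) : Q \subset Q' -> clique Q' -> clique Q.
Proof.
move=> /subsetP QQ' /forall_inP H; apply/forall_inP => x xQ; apply/forall_inP => y yQ.
by have /forall_inP := H x (QQ' x xQ); apply; apply: QQ'.
Qed.

(** Some [v] has degree below [d]: a clique containing [v] is [v] plus a subset of its neighbours,
    and the others lie in [S :\ v], which is sparse as well. *)
Lemma card_cliques d (S : {set T}) :
  (forall Y : {set T}, Y \subset S -> Y != set0 -> dsum a Y < d * #|Y|) ->
  #|[set Q : {set T} | [&& Q \subset S, Q != set0 & clique Q]]| <= #|S| * 2 ^ d.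
Proof.
have [n] := ubnP #|S|; elim: n S => // n IH S ltS hS.
have [S0|S0] := eqVneq S set0.
  rewrite S0 cards0 mul0n leqn0 cards_eq0; apply/eqP/setP => Q.
  by rewrite !inE subset0; case: eqP.
have [v vS dv] : exists2 v, v \in S & degree a S v < d.
  apply/exists_inP; apply: contraTT (hS S (subxx _) S0) => /exists_inPn H.
  rewrite -leqNgt mulnC -sum_nat_const; apply: leq_sum => v /H.
  by rewrite -leqNgt.
have SE : #|S| = #|S :\ v|.+1 by rewrite (cardsD1 v) vS.
set A := [set Q : {set T} | _].
pose B := [set Q : {set T} | [&& Q \subset S :\ v, Q != set0 & clique Q]].
pose C := [set v |: R | R in powerset [set w in S | a v w]].
have : A \subset B :|: C.
  apply/subsetP => Q; rewrite !in_setU !inE => /and3P[QS Q0 cQ].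
  case: (boolP (v \in Q)) => vQ; apply/orP; [right|left].
    apply/imsetP; exists (Q :\ v); last by rewrite setD1K.
    rewrite inE; apply/subsetP => w; rewrite !inE => /andP[wv wQ].
    rewrite (subsetP QS) //=.
    have /forall_inP/(_ w wQ)/implyP := forall_inP cQ v vQ; apply.
    by rewrite eq_sym.
  by rewrite subsetD1 QS vQ Q0.
move/subset_leq_card/leq_trans; apply.
rewrite cardsU; apply: leq_trans (leq_subr _ _) _.
rewrite SE mulSn addnC; apply: leq_add.
  apply: leq_trans (leq_imset_card _ _) _.
  by rewrite card_powerset leq_exp2l // ltnW.
apply: IH => [|Y YS]; first by rewrite SE in ltS.
by apply: hS; apply: subset_trans YS (subsetDl _ _).
Qed.

End Cliques.

(** * Disjoint connected sets with many attachments *)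

Section FamilyBound.
Variables (T : finType) (adj : rel T).
Hypothesis adj_sym : symmetric adj.
Implicit Types (S : {set T}) (M : {set {set T}}).

Definition swap (z : T * T) := (z.2, z.1).

Definition joined (end_ : {set T} -> T * T) M : rel T :=
  fun x y => [exists m in M, (end_ m == (x, y)) || (end_ m == (y, x))].

(* The members of [M] realise pairwise distinct edges on [S]. *)
Record assignment S M (end_ : {set T} -> T * T) : Prop := Assignment {
  assign_fst : forall m, m \in M -> (end_ m).1 \in S :&: nbhd adj m;
  assign_snd : forall m, m \in M -> (end_ m).2 \in S :&: nbhd adj m;
  assign_neq : forall m, m \in M -> (end_ m).1 != (end_ m).2;
  assign_inj : forall m m', m \in M -> m' \in M ->
    end_ m = end_ m' \/ end_ m = swap (end_ m') -> m = m' }.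

Lemma joined_sym end_ M : symmetric (joined end_ M).
Proof. by move=> x y; apply/eq_existsb => m; rewrite [X in _ && X]orbC. Qed.

Lemma joinedP end_ M x y :
  reflect (exists2 m, m \in M & end_ m = (x, y) \/ end_ m = (y, x))
          (joined end_ M x y).
Proof.
apply: (iffP exists_inP) => -[m mM H]; exists m => //.
  by case/orP: H => /eqP; [left|right].
by case: H => ->; rewrite eqxx ?orbT.
Qed.

Lemma joined_irr S M end_ : assignment S M end_ -> irreflexive (joined end_ M).
Proof.
move=> A x; apply/joinedP => -[m mM H]; have := assign_neq A mM.
by case: H => ->; rewrite eqxx.
Qed.

(** Greedy choice, one member at a time: either the attachments of [m] already form a clique, or a
    nonadjacent pair among them becomes the edge of [m]. Cliques survive when the graph grows. The
    vertex [x0] is a default value. *)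
Lemma assignment_exists (x0 : T) S M : exists (M1 : {set {set T}}) end_,
  [/\ M1 \subset M, assignment S M1 end_ &
    forall m, m \in M :\: M1 -> clique (joined end_ M1) (S :&: nbhd adj m)].
Proof.
have [n] := ubnP #|M|; elim: n M => // n IH M ltM.
have [M0|/set0Pn[m mM]] := eqVneq M set0.
  exists set0, (fun _ => (x0, x0)); split; first exact: sub0set.
    by split=> ?; rewrite inE.
  by move=> m; rewrite M0 !inE andbF.
have [|M1 [f [M1M A cl]]] := IH (M :\ m).
  by move: ltM; rewrite (cardsD1 m) mM.
have mM1 : m \notin M1 by apply/negP => /(subsetP M1M); rewrite !inE eqxx.
case: (boolP (clique (joined f M1) (S :&: nbhd adj m))) => [cm|].
  exists M1, f; split=> //; first by apply: subset_trans M1M (subsetDl _ _).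
  move=> m'; rewrite inE => /andP[m'M1 m'M].
  by case: (eqVneq m' m) => [-> //|ne]; apply: cl; rewrite !inE m'M1 ne.
rewrite negb_forall_in => /exists_inP[x xm]; rewrite negb_forall_in.
case/exists_inP => y ym; rewrite negb_imply => /andP[xy nj].
pose g m' := if m' == m then (x, y) else f m'.
have gm : g m = (x, y) by rewrite /g eqxx.
have gf m' : m' \in M1 -> g m' = f m'.
  by move=> m'M1; rewrite /g; case: eqP => // ?; subst; rewrite m'M1 in mM1.
exists (m |: M1), g; split.
- by rewrite subUset sub1set mM (subset_trans M1M) ?subsetDl.
- split=> [m' /setU1P[->|m'M1]|m' /setU1P[->|m'M1]|m' /setU1P[->|m'M1]|].
  + by rewrite gm.
  + by rewrite gf //; apply: assign_fst A _ _.
  + by rewrite gm.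
  + by rewrite gf //; apply: assign_snd A _ _.
  + by rewrite gm.
  + by rewrite gf //; apply: assign_neq A _ _.
  move=> m1 m2 /setU1P[->|m1M] /setU1P[->|m2M] //; rewrite ?gm ?(gf _ m1M) ?(gf _ m2M).
  + rewrite /swap => H; case/negP: nj; apply/joinedP; exists m2 => //.
    by case: H => [->|]; [left|case: (f m2) => u v [-> ->]; right].
  + by rewrite /swap /= => H; case/negP: nj; apply/joinedP; exists m1.
  + exact: assign_inj A _ _ m1M m2M.
move=> m'; rewrite !inE negb_or => /andP[/andP[ne m'M1] m'M].
have /cl /forall_inP H : m' \in (M :\ m) :\: M1 by rewrite !inE m'M1 ne.
apply/forall_inP => u uS; apply/forall_inP => v vS; apply/implyP => uv.
have /forall_inP/(_ v vS)/implyP/(_ uv)/joinedP[m1 m1M1 H1] := H u uS.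
by apply/joinedP; exists m1; [rewrite setU1r|rewrite gf].
Qed.

Variables (p : nat) (E : finType) (src tgt : E -> 'I_p).

(** Each joined edge that a link uses is replaced by the member realising it, which is connected and
    avoids [S]. *)
Lemma model_joined S M M1 end_ (Y : {set T}) phi link :
  {in M, forall m, conn adj m} -> {in M, forall m : {set T}, [disjoint m & S]} ->
  {in M &, forall m m' : {set T}, m != m' -> [disjoint m & m']} ->
  M1 \subset M -> assignment S M1 end_ -> Y \subset S ->
  model (joined end_ M1) src tgt [set: E] Y phi link ->
  exists link', model adj src tgt [set: E] [set: T] phi link'.
Proof.
move=> cM MS MM M1M A YS [phiI phiY linkY lc ls lt la ld].
have eT (e : E) : e \in [set: E] by rewrite inE.
have toM m : m \in M1 -> m \in M by apply: (subsetP M1M).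
pose near e := link e :|: [set phi (src e); phi (tgt e)].
(* The link of [e] absorbs [m] if the edge of [m] lies inside the link or runs from it to an end of
   [e]. *)
pose used e m := [&& m \in M1,
  ((end_ m).1 \in link e) || ((end_ m).2 \in link e), (end_ m).1 \in near e &
  (end_ m).2 \in near e].
pose link' e := link e :|: \bigcup_(m | used e m) m.
have mS m z : m \in M1 -> z \in m -> z \in S = false.
  by move=> /toM /MS d; apply: disjointFr d.
have linkS e : link e \subset S by apply: subset_trans (linkY e (eT e)) YS.
have sub e m : used e m -> m \subset link' e.
  by move=> ue; apply: subset_trans (subsetUr _ _); apply: bigcup_sup ue.
have sub0 e : link e \subset link' e by apply: subsetUl.
have touch m u v : m \in M1 -> u \in m -> end_ m = (v, (end_ m).2) \/
    end_ m = ((end_ m).1, v) -> exists2 w, w \in m & adj w v /\ connect (inside adj m) u w.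
  move=> mM1 um H; have : v \in nbhd adj m.
    have /setIP[_ h1] := assign_fst A mM1; have /setIP[_ h2] := assign_snd A mM1.
    by case: H h1 h2 => -> /=.
  case/nbhdP => _ [w wm vw]; exists w => //; rewrite adj_sym; split=> //.
  exact: (connP _ _ (cM _ (toM _ mM1))).
have ne m : m \in M1 -> exists u, u \in m.
  by move=> mM1; have /setIP[_ /nbhdP[_ [u um _]]] := assign_fst A mM1; exists u.
have jstep e x y : x \in link e -> y \in link e -> joined end_ M1 x y ->
    connect (inside adj (link' e)) x y.
  move=> xl yl /joinedP[m mM1 em].
  have ue : used e m.
    rewrite /used mM1 /near !in_setU; case: em => -> /=; rewrite xl yl //.
  have [u um] := ne m mM1.
  have [w wm [wx uw]] : exists2 w, w \in m & adj w x /\ connect (inside adj m) u w.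
    by apply: touch => //; case: em => -> /=; [left|right].
  have [w' wm' [wy uw']] : exists2 w, w \in m & adj w y /\ connect (inside adj m) u w.
    by apply: touch => //; case: em => -> /=; [right|left].
  apply: (@connect_trans _ _ w).
    by apply: connect1; rewrite /inside adj_sym wx (subsetP (sub _ _ ue) _ wm) (subsetP (sub0 e) _ xl).
  apply: (@connect_trans _ _ w'); last first.
    by apply: connect1; rewrite /inside wy (subsetP (sub _ _ ue) _ wm') (subsetP (sub0 e) _ yl).
  apply: (connect_inside (sub _ _ ue)); apply: connect_trans uw'.
  by rewrite connect_inside_sym.
have lconn e x y : x \in link e -> y \in link e -> connect (inside adj (link' e)) x y.
  move=> xl yl; have /connectP[s] := connP _ _ (lc e (eT e)) x y xl yl.
  elim: s x xl => [|z s IH] x xl /=; first by move=> _ ->; apply: connect0.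
  case/andP => /and3P[xz _ zl] ps ly; apply: connect_trans (IH z zl ps ly).
  exact: jstep.
have avoid e x : phi x \notin link' e.
  rewrite in_setU negb_or la //=; apply/bigcupP => -[m /and4P[mM1 _ _ _]].
  by move=> xm; have := mS _ _ mM1 xm; rewrite (subsetP YS _ (phiY x)).
have touch' e x : phi x \in [set phi (src e); phi (tgt e)] ->
    phi x \in nbhd (joined end_ M1) (link e) -> phi x \in nbhd adj (link' e).
  move=> xe /nbhdP[_ [y yl /joinedP[m mM1 H]]]; apply/nbhdP; split=> //.
  have ue : used e m.
    rewrite /used mM1 /near !(in_setU _ (link e)).
    by case: H => -> /=; rewrite yl xe ?orbT.
  have [u um] := ne m mM1.
  have [w wm [wx _]] : exists2 w, w \in m & adj w (phi x) /\ connect (inside adj m) u w.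
    by apply: touch => //; case: H => -> /=; [left|right].
  by exists w; [apply: (subsetP (sub _ _ ue))|rewrite adj_sym].
exists link'; split=> // [e _|e _|e _|e e' _ _ ee'].
- have /nbhdP[_ [x0 x0l _]] := ls e (eT e).
  apply: (@conn_star _ _ adj_sym _ x0); first exact: (subsetP (sub0 e)).
  move=> y; rewrite in_setU => /orP[yl|/bigcupP[m um ym]]; first exact: lconn.
  have /and4P[mM1 h _ _] := um.
  have [v vl H] : exists2 v, v \in link e & end_ m = (v, (end_ m).2) \/
    end_ m = ((end_ m).1, v).
    by case/orP: h => h; [exists (end_ m).1|exists (end_ m).2] => //;
      [left|right]; case: (end_ m).
  have [w wm [wv yw]] := touch m y v mM1 ym H.
  apply: connect_trans (lconn e _ _ x0l vl) _.
  apply: (@connect_trans _ _ w).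
    by apply: connect1; rewrite /inside adj_sym wv (subsetP (sub0 e) _ vl) (subsetP (sub _ _ um) _ wm).
  by apply: (connect_inside (sub _ _ um)); rewrite connect_inside_sym.
- by apply: touch' (ls e (eT e)); rewrite set21.
- by apply: touch' (lt e (eT e)); rewrite set22.
- have dl z : z \in link e -> z \notin link e'.
    by move=> zl; rewrite (disjointFr (ld e e' (eT _) (eT _) ee') zl).
  (* Hence no member is absorbed by two links: it has an end in [link e], and that end is not in
     [near e']. *)
  have nn z : z \in link e -> z \notin near e'.
    move=> zl; rewrite !in_setU !in_set1 negb_or dl //= negb_or.
    by apply/andP; split; apply: contraTneq zl => ->; apply: la.
  rewrite disjoint_subset; apply/subsetP => z; rewrite !inE negb_or.
  case/orP => [zl|/bigcupP[m um zm]].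
    rewrite dl //=; apply/bigcupP => -[m /and4P[mM1 _ _ _] zm].
    by have := mS _ _ mM1 zm; rewrite (subsetP (linkS e) _ zl).
  have /and4P[mM1 h _ _] := um.
  apply/andP; split.
    by apply: contraFN (mS _ _ mM1 zm); apply: (subsetP (linkS e')).
  apply/bigcupP => -[m' um' zm']; have /and4P[m'M1 _ h1 h2] := um'.
  have [mm'|mm'] := eqVneq m m'; last first.
    by have := disjointFr (MM _ _ (toM _ mM1) (toM _ m'M1) mm') zm; rewrite zm'.
  by case/orP: h => /nn; rewrite mm' ?h1 ?h2.
Qed.

(** [end_] is injective on [M], with values among the ordered adjacent pairs counted by [dsum]. *)
Lemma card_assigned S M end_ :
  assignment S M end_ -> #|M| <= dsum (joined end_ M) S.
Proof.
move=> A; set a := joined end_ M.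
have -> : dsum a S = #|[set z : T * T | [&& z.1 \in S, z.2 \in S & a z.1 z.2]]|.
  rewrite /dsum (eq_bigr (fun x => \sum_(y | (y \in S) && a x y) 1)); last first.
    by move=> x _; rewrite /degree -sum1_card; apply: eq_bigl => y; rewrite inE.
  rewrite pair_big_dep /= -sum1_card; apply: eq_bigl => z; by rewrite inE.
have eI : {in M &, injective end_}.
  by move=> m m' mM m'M H; apply: (assign_inj A) => //; left.
rewrite -(card_in_imset eI); apply/subset_leq_card/subsetP => z /imsetP[m mM ->].
have /setIP[h1 _] := assign_fst A mM; have /setIP[h2 _] := assign_snd A mM.
rewrite inE h1 h2 /=; apply/joinedP; exists m => //; left; exact: surjective_pairing.
Qed.

(** The density from which [mader] yields a model of all edges of [X]. *)
Definition sparsity := p * 2 ^ #|E|.+1.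

Hypothesis loopless : loopless_multigraph src tgt.
Hypothesis p_gt0 : 0 < p.
Hypothesis minor_free : topological_minor_free adj src tgt.

(** The first summand bounds the members assigned an edge; the second bounds the rest, at most
    [#|E|] for each clique of the joined graph. *)
Lemma family_bound S M :
  {in M, forall m, conn adj m} -> {in M, forall m : {set T}, [disjoint m & S]} ->
  {in M &, forall m m' : {set T}, m != m' -> [disjoint m & m']} ->
  {in M, forall m, p <= #|S :&: nbhd adj m|} ->
  #|M| <= (sparsity + #|E| * 2 ^ sparsity) * #|S|.
Proof.
move=> cM MS MM pM.
have [-> |/set0Pn[m0 m0M]] := eqVneq M set0; first by rewrite cards0.
have [x0 _] : exists x0, x0 \in S :&: nbhd adj m0.
  by apply/set0Pn; rewrite -card_gt0; apply: leq_trans (pM m0 m0M).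
have [M1 [end_ [M1M A cl]]] := assignment_exists x0 S M.
set a := joined end_ M1 in cl.
have sparse (Y : {set T}) : Y \subset S -> Y != set0 -> dsum a Y < sparsity * #|Y|.
  move=> YS Y0; rewrite ltnNge; apply/negP => H.
  have [|phi [link mo]] := mader (joined_sym _ _) (joined_irr A)
    src tgt p_gt0 (J := [set: E]) Y0.
    by rewrite cardsT.
  have [link' mo'] := model_joined cM MS MM M1M A YS mo.
  exact/minor_free/(model_topological_minor adj_sym loopless mo').
have cM1 : #|M1| <= sparsity * #|S|.
  apply: leq_trans (card_assigned A) _.
  have [->|S0] := eqVneq S set0; first by rewrite dsum0.
  exact/ltnW/sparse.
(* Exactly [p] attachments are selected; their order will number the branch vertices. *)
pose tup (m : {set T}) := take p (enum (S :&: nbhd adj m)).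
have tupP m : m \in M -> size (tup m) = p.
  by move=> mM; rewrite size_take_min -cardE; apply/minn_idPl/pM.
have tupU m : uniq (tup m) by apply/take_uniq/enum_uniq.
pose Q m := [set x in tup m].
have QS m : Q m \subset S :&: nbhd adj m.
  by apply/subsetP => x; rewrite inE => /mem_take; rewrite mem_enum.
pose K := [set R : {set T} | [&& R \subset S, R != set0 & clique a R]].
have QK m : m \in M :\: M1 -> Q m \in K.
  move=> mM; have mM' : m \in M by move: mM; rewrite inE => /andP[].
  rewrite inE (subset_trans (QS m)) ?subsetIl //= (clique_sub (QS m) (cl m mM)) andbT.
  by rewrite -card_gt0 cardsE (card_uniqP (tupU m)) tupP.
(* More than [#|E|] members with the same [p] selected attachments would supply distinct links for
   all edges of [X]. *)
have fiber R : #|[set m in M :\: M1 | Q m == R]| <= #|E|.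
  rewrite leqNgt; apply/negP => ltE.
  set F := [set m in _ | _] in ltE.
  pose link (e : E) := nth m0 (enum F) (enum_rank e).
  have sF : size (enum F) = #|F| by rewrite -cardE.
  have ltF (e : E) : enum_rank e < size (enum F).
    by rewrite sF; apply: leq_trans ltE; rewrite ltnS; apply/ltnW/ltn_ord.
  have linkF e : link e \in F by rewrite -mem_enum mem_nth.
  have FM m : m \in F -> m \in M by rewrite !inE => /andP[/andP[]].
  have [m1 m1F] : exists m1, m1 \in F.
    by apply/set0Pn; rewrite -card_gt0; apply: leq_ltn_trans ltE.
  have QF m : m \in F -> Q m = Q m1.
    by move: m1F; rewrite !inE => /andP[_ /eqP ->] /andP[_ /eqP].
  pose phi (x : 'I_p) := nth x0 (tup m1) x.
  have phiQ x : phi x \in Q m1 by rewrite inE mem_nth // tupP // FM.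
  have phiN x e : phi x \in S :&: nbhd adj (link e).
    by apply: (subsetP (QS _)); rewrite QF.
  apply: minor_free; apply: (@model_topological_minor _ _ _ _ _ _ adj_sym loopless [set: T] phi link).
  split=> // [x y /eqP|e _|e _|e _|e x _|e e' _ _ ne].
  - rewrite nth_uniq ?tupP ?FM // => /eqP; exact: val_inj.
  - by apply/cM/FM.
  - by have /setIP[] := phiN (src e) e.
  - by have /setIP[] := phiN (tgt e) e.
  - by have /setIP[_ /nbhdP[]] := phiN x e.
  - apply: MM; [exact/FM|exact/FM|]; apply: contra ne.
    by rewrite nth_uniq ?enum_uniq // => /eqP/ord_inj/enum_rank_inj ->.
have cM2 : #|M :\: M1| <= #|E| * (#|S| * 2 ^ sparsity).
  apply: leq_trans (leq_mul (leqnn _) (card_cliques sparse)).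
  rewrite -sum1_card (partition_big Q (mem K)) //= mulnC -sum_nat_const.
  apply: leq_sum => R _; apply: leq_trans (fiber R).
  by rewrite -sum1_card; apply: eq_leq; apply: eq_bigl => m; rewrite !inE.
rewrite -(cardsID M1 M) (setIidPr M1M) mulnDl leq_add //.
by apply: leq_trans cM2 _; rewrite [#|S| * _]mulnC mulnA.
Qed.

End FamilyBound.

(** * Tree decompositions: packing, hitting and splitting *)

Section Bags.
Variables (T : finType) (adj : rel T) (I : finType) (tr : rel I).
Variables (B : I -> {set T}) (K : nat).
Hypothesis dec : tree_decomposition adj tr B.
Hypothesis small_bag : forall i, #|B i| <= K.
Implicit Types (A C : {set I}) (D W Z : {set T}).

Let tr_sym : symmetric tr. Proof. by case: dec => -[[]]. Qed.

Definition bags A := \bigcup_(j in A) B j.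

(* [A] can be left only through [i]. *)
Definition branch i A :=
  (i \in A) && [forall j in A, forall b, tr j b && (b \notin A) ==> (j == i)].

Lemma branchP i A j b : branch i A -> j \in A -> tr j b -> b \notin A -> j = i.
Proof.
case/andP => _ /forall_inP H jA jb bA.
by have /forallP/(_ b) := H j jA; rewrite jb bA => /eqP.
Qed.

Lemma bags_setT : bags [set: I] = [set: T].
Proof.
apply/setP => v; rewrite inE; case: dec => _ [H _].
by have [i vi] := H v; apply/bigcupP; exists i.
Qed.

Lemma bags_sub A C : A \subset C -> bags A \subset bags C.
Proof.
move=> /subsetP AC; apply/bigcupsP => j jA; exact: (bigcup_sup _ (AC j jA)).
Qed.

(** A path from [j] to [j'] avoiding [i] would close to a cycle through [i]. *)
Lemma tree_neighbour_inj i j j' : tr i j -> tr i j' ->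
  connect (inside tr (~: [set i])) j j' -> j = j'.
Proof.
move=> ij ij' /connectP[s]; case/shortenP => s' ps us _ lj'.
case: dec => -[[_ irr] [_ [_ acyc]]] _.
case: s' ps us lj' => [//|z s'] ps us lj'.
suff /(acyc [:: i, j, z & s'] isT)/negP[] : uniq [:: i, j, z & s'].
  rewrite (cycle_path i) /= -[last z s']/(last j (z :: s')) -lj' tr_sym ij' ij /=.
  by apply: (sub_path _ ps) => u v /and3P[].
rewrite cons_uniq us andbT; apply/negP => is'.
have iji : i != j by apply: contraTneq ij => ->; rewrite irr.
suff H u t : path (inside tr (~: [set i])) u t -> i \notin t.
  by move: is'; rewrite inE (negPf iji) /= => is'; have := H _ _ ps; rewrite is'.
elim: t u => [//|w t IH] u /= /andP[/and3P[_ _ wi] /IH it].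
by rewrite inE negb_or it andbT; move: wi; rewrite !inE eq_sym.
Qed.

(* A connected set [D] avoiding the bag [B i] lives in the bags of one component
   of the tree minus [i]. *)
Lemma branch_step i A D : branch i A -> conn adj D -> [disjoint D & B i] ->
  ([disjoint D & bags A] /\ nbhd adj D :&: bags A \subset B i) \/
  exists j C, [/\ branch j C, #|C| < #|A|, C \subset A &
                  D :|: nbhd adj D \subset bags C].
Proof.
move=> brA cD DB; have [_ [cover [edge sub]]] := dec.
have iA : i \in A by case/andP: brA.
(* The nodes whose bags meet [D] span a connected part of the tree, because [D] is connected; this
   part misses [i]. *)
pose N := [set j | ~~ [disjoint D & B j]].
have NP j v : v \in D -> v \in B j -> j \in N.
  by move=> vD vj; rewrite inE; apply/pred0Pn; exists v; rewrite /= vD.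
have iN : i \notin N by rewrite inE DB.
have stepN j b v : v \in D -> v \in B j -> v \in B b -> connect (inside tr N) j b.
  move=> vD vj vb; apply: connect_sub (sub v j b vj vb) => x y /and3P[xy vx vy].
  by apply: connect1; rewrite /inside xy !(NP _ v).
have cN j b : j \in N -> b \in N -> connect (inside tr N) j b.
  rewrite !inE => /pred0Pn[v /andP[/= vD vj]] /pred0Pn[w /andP[/= wD wb]].
  have /connectP[s] := connP _ _ cD _ _ vD wD.
  elim: s v vD j vj => [|u s IH] v vD j vj /=.
    by move=> _ wv; apply: stepN vD vj _; rewrite -wv.
  case/andP => /and3P[vu _ uD] ps lw.
  have [c /andP[vc uc]] := edge v u vu.
  exact: connect_trans (stepN _ _ _ vD vj vc) (IH u uD c uc ps lw).
have NiN : N \subset ~: [set i].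
  by apply/subsetP => j jN; rewrite !inE; apply: contraTneq jN => ->.
(* A walk out of [A] passes through [i], its only exit. *)
have leave X j b : connect (inside tr X) j b -> j \in A -> b \notin A -> i \in X.
  case/connectP => s; elim: s j => [|u s IH] j /=; first by move=> _ -> ->.
  case/andP => /and3P[ju jX uX] ps lb jA bA.
  by case: (boolP (u \in A)) => uA; [apply: IH ps lb uA bA|rewrite -(branchP brA jA ju uA)].
case: (boolP [disjoint N & A]) => NA.
  left; split.
    rewrite disjoint_subset; apply/subsetP => v vD; rewrite inE.
    apply/bigcupP => -[j jA vj]; have := disjointFl NA jA.
    by rewrite (NP j v).
  apply/subsetP => w /setIP[/nbhdP[_ [v vD wv]] /bigcupP[j jA wj]].
  have [b /andP[wb vb]] := edge w v wv.
  have bA : b \notin A by rewrite (disjointFr NA (NP b v vD vb)).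
  have := leave [set c | w \in B c] j b; rewrite inE; apply=> //.
  apply: connect_sub (sub w j b wj wb) => x y /and3P[xy wx wy].
  by apply: connect1; rewrite /inside xy !inE wx.
right; have /pred0Pn[c /andP[/= cNc cA]] := NA.
have ci : c \notin [set i] by apply: contra iN => /set1P <-.
pose C := component tr [set i] c.
have Ci : i \notin C by rewrite (disjointFl (component_sub tr ci)) ?set11.
have CA : C \subset A.
  apply/subsetP => b; rewrite inE => cb; apply: contraT => bA.
  by have := leave _ _ _ cb cA bA; rewrite !inE eqxx.
have NC : N \subset C.
  by apply/subsetP => b bN; rewrite inE; apply: (connect_inside NiN); apply: cN.
have ltC : #|C| < #|A|.
  by apply/proper_card/properP; split=> //; exists i.
have dC : D :|: nbhd adj D \subset bags C.
  apply/subsetP => w; rewrite in_setU => /orP[wD|/nbhdP[_ [v vD wv]]].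
    by have [b wb] := cover w; apply/bigcupP; exists b => //; apply/(subsetP NC)/(NP b w).
  have [b /andP[wb vb]] := edge w v wv.
  by apply/bigcupP; exists b => //; apply/(subsetP NC)/(NP b v).
suff [j brj] : exists j, branch j C by exists j, C.
(* By closure of the component, every edge leaving [C] ends in [i]; acyclicity then allows only one
   node of [C] next to [i]. *)
have exit b x : b \in C -> tr b x -> x \notin C -> x = i.
  move=> bC bx xC; apply/eqP/negPn/negP => xi.
  by rewrite (component_closed ci bC _ bx) // inE in xC.
case: (boolP [exists j in C, tr j i]) => [/exists_inP[j jC ji]|/exists_inPn no].
  exists j; apply/andP; split=> //; apply/forall_inP => b bC; apply/forallP => x.
  apply/implyP => /andP[bx xC]; have xi := exit b x bC bx xC.
  apply/eqP/(@tree_neighbour_inj i); [by rewrite tr_sym -xi|by rewrite tr_sym|].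
  apply: connect_inside (connP _ _ (conn_component tr_sym ci) _ _ bC jC).
  by apply/subsetP => y yC; rewrite !inE; apply: contraTneq yC => ->.
(* No edge leaves [C] here, so any of its nodes can serve as the exit. *)
exists c; rewrite /branch mem_component; apply/forall_inP => b bC; apply/forallP => x.
apply/implyP => /andP[bx xC]; have xi := exit b x bC bx xC.
by have := no b bC; rewrite -xi bx.
Qed.

Lemma branch_setT : exists i, branch i [set: I].
Proof.
case: dec => -[_ [I0 _]] _; case/card_gt0P: I0 => i _; exists i.
by rewrite /branch inE; apply/forall_inP => j _; apply/forallP => b; rewrite inE andbF.
Qed.

(** A branch with fewest nodes replaces the lowest node of a rooted tree. *)
Lemma minimal_branch (P : pred {set I}) : P [set: I] ->
  exists i A, [/\ branch i A, P A &
    forall j C, branch j C -> P C -> #|A| <= #|C|].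
Proof.
move=> PT; have [i0 br0] := branch_setT.
pose Q (z : I * {set I}) := branch z.1 z.2 && P z.2.
have Q0 : Q (i0, [set: I]) by rewrite /Q br0.
case: (arg_minnP (fun z : I * {set I} => #|z.2|) Q0) => -[i A] /andP[/= brA PA] H.
exists i, A; split=> // j C brC PC; apply: (H (j, C)).
by rewrite /Q /= brC.
Qed.

(** Erdos-Posa by induction on [l]: for a smallest branch whose bags contain a member, any member
    that meets these bags meets [B i], since otherwise it would lie in a smaller branch. Members
    missing the bags are handled recursively. *)
Lemma packing_or_hitting l (F : {set {set T}}) :
  {in F, forall D, conn adj D /\ D != set0} ->
  (exists M : {set {set T}}, [/\ M \subset F, #|M| = l &
     {in M &, forall D D' : {set T}, D != D' -> [disjoint D & D']}]) \/
  exists Y : {set T}, #|Y| <= l * K /\ {in F, forall D, ~~ [disjoint D & Y]}.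
Proof.
elim: l F => [|l IH] F cF.
  by left; exists set0; split; rewrite ?sub0set ?cards0 // => ?; rewrite inE.
have [F0|/set0Pn[D0 D0F]] := eqVneq F set0.
  by right; exists set0; rewrite cards0; split=> // D; rewrite F0 inE.
have [|i [A [brA /exists_inP[D1 D1F D1A] minA]]] :=
  @minimal_branch (fun A => [exists D in F, D \subset bags A]).
  by apply/exists_inP; exists D0 => //; rewrite bags_setT subsetT.
pose F' := [set D in F | [disjoint D & bags A]].
have [|[M [MF' cM dM]]|[Y [cY hY]]] := IH F'.
- by move=> D; rewrite inE => /andP[/cF].
- left; exists (D1 |: M).
  have MA D : D \in M -> [disjoint D1 & D].
    move=> /(subsetP MF'); rewrite inE disjoint_sym => /andP[_ d].
    exact: disjointWl D1A d.
  have D1M : D1 \notin M.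
    apply/negP => /MA; have [_ /set0Pn[v vD]] := cF _ D1F.
    by move/disjointFr/(_ vD); rewrite vD.
  split.
  + rewrite subUset sub1set D1F; apply: subset_trans MF' _.
    by apply/subsetP => D; rewrite inE => /andP[].
  + by rewrite cardsU1 D1M cM.
  + move=> D D' /setU1P[->|DM] /setU1P[->|D'M] ne; rewrite ?eqxx // in ne *.
    * exact: MA.
    * by rewrite disjoint_sym MA.
    * exact: dM.
- right; exists (B i :|: Y); split.
    by rewrite cardsU mulSn; apply: leq_trans (leq_subr _ _) _; apply: leq_add.
  move=> D DF; apply/negP => d.
  have dB := disjointWr (subsetUl _ _) d; have dY := disjointWr (subsetUr _ _) d.
  have [cD _] := cF _ DF.
  case: (branch_step brA cD dB) => [[dA _]|[j [C [brC ltC _ DC]]]].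
    have DF' : D \in F' by rewrite inE DF.
    by have := hY D DF'; rewrite dY.
  have PC : [exists D in F, D \subset bags C].
    by apply/exists_inP; exists D => //; apply: subset_trans DC; apply: subsetUl.
  by have := minA j C brC PC; rewrite leqNgt ltC.
Qed.

(** Repeatedly take a smallest branch with more than [2 * K] vertices of [W] and replace these by
    its exit bag: [Z] gains at most [K] vertices while [W] shrinks by more than [K]. *)
Lemma split_boundary W : exists Z, #|Z| <= #|W| /\
  forall D, conn adj D -> [disjoint D & W :|: Z] ->
    #|nbhd adj D :&: (W :|: Z)| <= 4 * K.
Proof.
have [n] := ubnP #|W|; elim: n W => // n IH W ltW.
have [leW|gtW] := leqP #|W| (4 * K).
  exists set0; rewrite cards0; split=> // D _ _; rewrite setU0.
  by apply: leq_trans leW; apply/subset_leq_card/subsetIr.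
have [|i [A [brA bigA minA]]] :=
  @minimal_branch (fun A => 2 * K < #|bags A :&: W|).
  by rewrite bags_setT setTI; apply: leq_ltn_trans gtW; rewrite leq_mul2r orbT.
pose W' := (W :\: bags A) :|: B i.
have cW' : #|W'| + K < #|W|.
  have : #|W'| <= #|W :\: bags A| + #|B i|.
    by rewrite cardsU leq_subr.
  have := small_bag i; have := cardsID (bags A) W; rewrite [W :&: _]setIC; lia.
have [|Z' [cZ' hZ']] := IH W'; first by lia.
(* Dropping [bags A] from [Z'] leaves only [W] and [B i] to be counted inside the branch. *)
exists (B i :|: (Z' :\: bags A)); split.
  have : #|B i :|: (Z' :\: bags A)| <= #|B i| + #|Z' :\: bags A|.
    by rewrite cardsU leq_subr.
  have : #|Z' :\: bags A| <= #|Z'| by apply/subset_leq_card/subsetDl.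
  by have := small_bag i; lia.
move=> D cD dD; have dB : [disjoint D & B i].
  by apply: disjointWr dD; rewrite setUA -setUA setUCA subsetUl.
case: (branch_step brA cD dB) => [[dA nA]|[j [C [brC ltC CA DC]]]].
  have dW' : [disjoint D & W' :|: Z'].
    rewrite disjoint_subset; apply/subsetP => v vD; rewrite inE.
    have := disjointFr dA vD; have := disjointFr dD vD.
    by rewrite !in_setU !in_setD => H1 H2; move: H1; rewrite H2 /=; case: (v \in B i);
      case: (v \in W); case: (v \in Z').
  apply: leq_trans (hZ' D cD dW'); apply/subset_leq_card/subsetP => v.
  rewrite in_setI => /andP[vN vW]; rewrite in_setI vN /=; move: vW.
  rewrite !in_setU !in_setD; case: (boolP (v \in bags A)) => vA; last first.
    by case: (v \in W); case: (v \in B i); case: (v \in Z').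
  by rewrite (subsetP nA) ?orbT // in_setI vN.
(* By minimality a smaller branch has at most [2 * K] vertices of [W]; with [B i] this makes at most
   [3 * K]. *)
have CW : #|bags C :&: W| <= 2 * K.
  by rewrite leqNgt; apply: contraTN ltC => /(minA j C brC); rewrite -leqNgt.
apply: (@leq_trans #|(bags C :&: W) :|: B i|).
  apply/subset_leq_card/subsetP => v; rewrite in_setI => /andP[vN].
  have vC : v \in bags C by apply: (subsetP DC); rewrite in_setU vN orbT.
  have vA : v \in bags A by apply: (subsetP (bags_sub CA)).
  by rewrite !in_setU in_setD in_setI vC vA /= orbF.
rewrite cardsU; apply: leq_trans (leq_subr _ _) _.
by have := small_bag i; lia.
Qed.

End Bags.

(** * Elimination schemes and the treewidth of the quotient *)

Section Elimination.
Variables (T : finType) (p : nat).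
Implicit Types (U Q : {set T}) (X : {set {set T}}).

(* Bags of a perfect elimination scheme built in reverse: the vertices of [U]
   arrive one at a time, each with at most [p] earlier neighbours, which lie in
   an existing bag. *)
Inductive elimination : {set T} -> {set {set T}} -> Prop :=
| Elim0 : elimination set0 [set set0]
| ElimS U X x Q Q' : elimination U X -> x \notin U -> Q' \in X ->
    Q \subset Q' -> #|Q| <= p -> elimination (x |: U) ((x |: Q) |: X).

Lemma elimination_sub U X Q : elimination U X -> Q \in X -> Q \subset U.
Proof.
move=> e; elim: e Q => {U X} [|U X x Q Q' _ IH _ Q'X QQ' _] R.
  by rewrite inE => /eqP ->.
case/setU1P => [->|/IH RU]; last exact: subset_trans RU (subsetUr _ _).
by apply: setUS; apply: subset_trans QQ' (IH _ Q'X).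
Qed.

Lemma elimination_card U X Q : elimination U X -> Q \in X -> #|Q| <= p.+1.
Proof.
move=> e; elim: e Q => {U X} [|U X x Q Q' _ IH _ _ _ cQ] R.
  by rewrite inE => /eqP ->; rewrite cards0.
case/setU1P => [->|/IH //]; rewrite cardsU1 -add1n leq_add //.
by case: (x \notin Q).
Qed.

(** The remaining vertices arrive with no earlier neighbours. *)
Lemma elimination_total U X : elimination U X ->
  exists2 X' : {set {set T}}, X \subset X' & elimination [set: T] X'.
Proof.
have [n] := ubnP #|~: U|; elim: n U X => // n IH U X ltU e.
have [U0|/set0Pn[x xU]] := eqVneq (~: U) set0.
  by exists X; rewrite // -setC0 -U0 setCK.
have xU' : x \notin U by rewrite -in_setC.
have [Q QX] : exists Q, Q \in X.
  by case: e => [|U' X' y Q Q' *]; [exists set0; rewrite inE|exists (y |: Q); rewrite setU11].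
have e' := ElimS e xU' QX (sub0set _) (_ : #|set0| <= p); rewrite cards0 in e'.
have [|X' XX' eX'] := IH _ _ _ (e' isT).
  by move: ltU; rewrite (cardsD1 x (~: U)) xU setCU setIC -setDE.
by exists X' => //; apply: subset_trans XX'; apply: subsetUr.
Qed.

Section Leaf.
Variables (I : finType) (tr : rel I) (i0 : I).

Definition add_leaf : rel (option I) := fun a b =>
  match a, b with
  | Some i, Some j => tr i j
  | Some i, None | None, Some i => i == i0
  | None, None => false
  end.

Lemma connect_Some (e : rel I) (e' : rel (option I)) i j :
  (forall a b, e a b -> e' (Some a) (Some b)) ->
  connect e i j -> connect e' (Some i) (Some j).
Proof.
move=> H /connectP[s]; elim: s i => [|u s IH] i /=; first by move=> _ ->; apply: connect0.
case/andP => /H iu ps lj; exact: connect_trans (connect1 iu) (IH u ps lj).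
Qed.

Lemma add_leaf_tree : is_tree tr -> is_tree add_leaf.
Proof.
case=> -[sym irr] [_ [con acyc]].
have sym' : symmetric add_leaf by case=> [i|] [j|] //=; apply: sym.
have c0 a : connect add_leaf a (Some i0).
  case: a => [i|]; last by apply: connect1; rewrite /= eqxx.
  exact: connect_Some (con i i0).
split; first by split=> //; case=> //= i; apply: irr.
split; first by rewrite card_option.
split=> [a b|s s3 us].
  by apply: connect_trans (c0 a) _; rewrite (sym_connect_sym sym').
(* The new node has [i0] as its only neighbour, so a cycle through it would visit [i0] twice; other
   cycles come from [tr]. *)
case: (boolP (None \in s)) => [/rot_to[k s' es]|Ns].
  rewrite -(rot_cycle k) es; move: s3 us; rewrite -(size_rot k) -(rot_uniq k) es.
  case: s' {es} => [//|[i|] s'] //= s3 /and3P[_ is' _].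
  case/lastP: s' s3 is' => [//|s' b] _ is'; rewrite !rcons_path last_rcons.
  apply/negP => /and3P[/eqP ii0 _ b0].
  case: b b0 is' => [b|] //= /eqP ->; rewrite ii0 mem_rcons inE eqxx.
  by [].
have [s' es] : exists s', s = map Some s'.
  exists (pmap (fun o => o) s); elim: s Ns {s3 us} => [//|[i|] s IH] //=.
  by rewrite inE => /= /IH {1}->.
move: s3 us; rewrite es size_map map_inj_uniq => [s3 us|x y [] //].
apply: contra (acyc s' s3 us); case: s' {es s3 us} => [//|i s'] /=.
by rewrite -map_rcons path_map.
Qed.

End Leaf.

(** Each arrival attaches a leaf with bag [x |: Q] to a node with bag [Q']. As [x] is new and
    [Q \subset Q'], the nodes holding a given vertex stay connected. *)
Lemma elimination_tree U X : elimination U X ->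
  exists (I : finType) (tr : rel I) (B : I -> {set T}),
    [/\ is_tree tr, forall i, B i \in X, forall Q, Q \in X -> exists i, B i = Q,
        forall v, v \in U -> exists i, v \in B i &
        forall v i j, v \in B i -> v \in B j ->
          connect [rel a b | [&& tr a b, v \in B a & v \in B b]] i j].
Proof.
elim=> {U X} [|U X x Q Q' e [I [tr [B [tree BX XB cov con]]]] xU Q'X QQ' _].
  exists unit, (fun _ _ => false), (fun _ => set0); split.
  - split; first by split.
    split; first by rewrite card_unit.
    split=> [[] []|[|a [|b s]] //]; exact: connect0.
  - by move=> _; rewrite inE.
  - by move=> Q; rewrite inE => /eqP ->; exists tt.
  - by move=> v; rewrite inE.
  - by move=> v i j; rewrite inE.
have [i0 Bi0] := XB Q' Q'X.
pose B' (o : option I) := if o is Some i then B i else x |: Q.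
exists (option I), (add_leaf tr i0), B'; split.
- exact: add_leaf_tree.
- by case=> [i|] /=; rewrite ?setU11 // setU1r.
- move=> R /setU1P[->|/XB[i Bi]]; [by exists None|by exists (Some i)].
- move=> v /setU1P[->|/cov[i vi]]; [by exists None; rewrite /= setU11|by exists (Some i)].
have sup v i j : v \in B i -> v \in B j ->
    connect [rel a b | [&& add_leaf tr i0 a b, v \in B' a & v \in B' b]] (Some i) (Some j).
  by move=> vi vj; apply: connect_Some (con v i j vi vj).
have leaf v j : v \in x |: Q -> v \in B j -> v \in B i0.
  case/setU1P => [->|/(subsetP QQ')]; last by rewrite Bi0.
  by move/(subsetP (elimination_sub e (BX j))); rewrite (negPf xU).
move=> v [i|] [j|] /= vi vj; first exact: sup.
- apply: (@connect_trans _ _ (Some i0)); first by apply: sup => //; apply: leaf vj vi.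
  by apply: connect1; rewrite /= eqxx vj (leaf v i).
- apply: (@connect_trans _ _ (Some i0)); last by apply: sup => //; apply: leaf vi vj.
  by apply: connect1; rewrite /= eqxx vi (leaf v j).
- exact: connect0.
Qed.

(** The densest graph admitting the sets in [X] as bags; it will be the quotient. *)
Definition cobag X : rel T :=
  fun x y => (x != y) && [exists Q in X, (x \in Q) && (y \in Q)].

Lemma cobag_simple X : simple_graph (cobag X).
Proof.
split=> [x y|x]; last by rewrite /cobag eqxx.
by rewrite /cobag eq_sym; congr (_ && _); apply/eq_existsb => Q; rewrite [X in _ && X]andbC.
Qed.

Lemma cobag_tw X : elimination [set: T] X -> tw_le (cobag X) p.
Proof.
move=> e; have [I [tr [B [tree BX XB cov con]]]] := elimination_tree e.
exists I, tr, B; split=> [|i]; last exact: elimination_card e (BX i).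
split=> //; split; first by move=> v; apply: cov; rewrite inE.
split=> // v w /andP[_ /exists_inP[Q QX vw]].
by have [i Bi] := XB Q QX; exists i; rewrite Bi.
Qed.

End Elimination.

(** * Building the partition part by part *)

Section Construction.
Variables (T : finType) (adj : rel T) (I : finType) (tr : rel I).
Variables (B : I -> {set T}) (K : nat).
Variables (p : nat) (E : finType) (src tgt : E -> 'I_p).
Hypothesis adj_simple : simple_graph adj.
Hypothesis dec : tree_decomposition adj tr B.
Hypothesis small_bag : forall i, #|B i| <= K.
Hypothesis loopless : loopless_multigraph src tgt.
Hypothesis p_gt0 : 0 < p.
Hypothesis minor_free : topological_minor_free adj src tgt.

Let adj_sym : symmetric adj := adj_simple.1.

(** The constant of [family_bound]: disjoint sets per attachment vertex. *)
Definition density := sparsity p E + #|E| * 2 ^ sparsity p E.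

(** Old attachments, a hitting set and one vertex, doubled by the set from [split_boundary]. *)
Definition part_bound := 2 * (4 * K + (density * (4 * K)).+1 * K + 1).

(* [f] names each part by one of its vertices; [U] is the set of names in use. *)
Record partial_partition (L : {set T}) (f : T -> T) (U : {set T})
    (X : {set {set T}}) : Prop := PartialPartition {
  pp_elim : elimination p U X;
  pp_names : U \subset L;
  pp_name : forall v, v \in L -> f v \in U;
  pp_edge : forall v w, v \in L -> w \in L -> adj v w ->
    exists2 Q, Q \in X & (f v \in Q) && (f w \in Q);
  pp_width : forall x, #|[set v in L | f v == x]| <= part_bound;
  pp_small : forall D : {set T}, conn adj D -> [disjoint D & L] ->
    #|nbhd adj D :&: L| <= 4 * K;
  pp_bag : forall D : {set T}, conn adj D -> [disjoint D & L] ->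
    #|f @: (nbhd adj D :&: L)| <= p /\
    exists2 Q, Q \in X & f @: (nbhd adj D :&: L) \subset Q }.

(** [family_bound] excludes a packing of [density * (4 * K) + 1] subsets with [p] attachments, so
    [packing_or_hitting] returns the other alternative. *)
Lemma hitting_set (D S : {set T}) : [disjoint D & S] -> #|S| <= 4 * K ->
  exists2 Y : {set T}, #|Y| <= (density * (4 * K)).+1 * K &
    forall D' : {set T}, D' \subset D -> conn adj D' -> [disjoint D' & Y] ->
      #|S :&: nbhd adj D'| < p.
Proof.
move=> DS cS; pose F := [set D' : {set T} |
  [&& D' \subset D, conn adj D', D' != set0 & p <= #|S :&: nbhd adj D'|]].
have [|[M [MF cM dM]]|[Y [cY hY]]] :=
  packing_or_hitting dec small_bag (density * (4 * K)).+1 (F := F).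
- by move=> D'; rewrite inE => /and4P[].
- have FM m : m \in M -> m \in F by apply: (subsetP MF).
  have := family_bound adj_sym loopless p_gt0 minor_free (S := S) (M := M).
  rewrite cM; move/(_ _ _ dM _).
  have H1 : {in M, forall m, conn adj m} by move=> m /FM; rewrite inE => /and4P[].
  have H2 : {in M, forall m : {set T}, [disjoint m & S]}.
    by move=> m /FM; rewrite inE => /and4P[mD _ _ _]; apply: disjointWl mD DS.
  have H3 : {in M, forall m, p <= #|S :&: nbhd adj m|}.
    by move=> m /FM; rewrite inE => /and4P[].
  move=> /(_ H1 H2 H3) H; have := leq_trans H (leq_mul (leqnn _) cS).
  by rewrite ltnn.
exists Y => // D' D'D cD' dY; rewrite ltnNge; apply/negP => pS.
have D'0 : D' != set0.
  apply: contraTneq pS => ->; rewrite (_ : _ :&: _ = set0) ?cards0 -?ltnNge //.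
  apply/setP => x; rewrite in_setI inE in_set0; apply/negP => /and3P[_ _].
  by case/exists_inP => y; rewrite inE.
by have := hY D'; rewrite dY inE D'D cD' D'0 pS => /(_ isT).
Qed.

(** The new part lies in one component [D] of the complement and hits every connected subset of [D]
    with [p] attachments. A connected set left in [D] sees fewer than [p] old parts, so the new part
    brings the number to at most [p]. *)
Lemma partial_partition_step L f U X v : partial_partition L f U X -> v \notin L ->
  exists L' f' U' X', #|~: L'| < #|~: L| /\ partial_partition L' f' U' X'.
Proof.
move=> P vL; pose D := component adj L v; pose S := nbhd adj D :&: L.
have cD : conn adj D by apply: conn_component.
have DL : [disjoint D & L] by apply: component_sub.
have DS : [disjoint D & S] by apply: disjointWr DL; apply: subsetIr.
have cS : #|S| <= 4 * K by apply: (pp_small P).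
have [hit chit hitP] := hitting_set DS cS.
(* Including [v] names the part and guarantees progress. *)
pose W := S :|: hit :|: [set v].
have [Z [cZ hZ]] := split_boundary dec small_bag W.
have [fS [Q QX SQ]] := pp_bag P cD DL; rewrite -/S in fS SQ.
(* Intersecting with [D] keeps the part off [L] and away from other components. *)
pose Y := (hit :|: [set v] :|: Z) :&: D.
have vD : v \in D by apply: mem_component.
have vY : v \in Y by rewrite in_setI vD !in_setU set11 orbT.
have YD : Y \subset D by apply: subsetIr.
have YL z : z \in L -> z \notin Y.
  by move=> zL; apply/negP => /(subsetP YD) zD; rewrite (disjointFr DL zD) in zL.
have vU : v \notin U by apply: contra vL; apply: (subsetP (pp_names P)).
have cY : #|Y| <= part_bound.
  have YWZ : #|Y| <= #|W :|: Z|.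
    apply/subset_leq_card; apply: subset_trans (subsetIl _ _) _.
    by apply: setSU; apply: setSU; apply: subsetUr.
  have : #|W :|: Z| <= #|W| + #|Z| by rewrite cardsU leq_subr.
  have : #|W| <= #|S :|: hit| + 1 by rewrite /W cardsU cards1 leq_subr.
  have : #|S :|: hit| <= #|S| + #|hit| by rewrite cardsU leq_subr.
  move: YWZ cZ cS chit; rewrite /part_bound.
  move: ((density * (4 * K)).+1 * K) (4 * K) #|Y| #|W :|: Z| #|W| #|Z| #|S :|: hit| #|S| #|hit|.
  by clear; lia.
pose f' z := if z \in Y then v else f z.
have f'L z : z \in L -> f' z = f z by move=> zL; rewrite /f' (negPf (YL z zL)).
have f'Y z : z \in Y -> f' z = v by rewrite /f' => ->.
(* A neighbour of [Y] in [L] is an attachment of [D], so its part belongs to the new bag. *)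
have new_edge y z : y \in Y -> z \in L :|: Y -> adj y z ->
    exists2 R, R \in (v |: f @: S) |: X & (f' y \in R) && (f' z \in R).
  move=> yY zLY yz; exists (v |: f @: S); rewrite ?setU11 //= f'Y // setU11 /=.
  case/setUP: zLY => [zL|zY]; last by rewrite f'Y // setU11.
  rewrite f'L // setU1r // imset_f // in_setI zL andbT; apply/nbhdP; split.
    by apply/negP => zD; rewrite (disjointFr DL zD) in zL.
  by exists y; [apply: (subsetP YD)|rewrite adj_sym].
exists (L :|: Y), f', (v |: U), ((v |: f @: S) |: X); split.
  apply/proper_card/properP; split.
    by rewrite setCS subsetUl.
  by exists v; rewrite !in_setC // negbK in_setU vY orbT.
(* A connected set off the new parts lies either in [D] or away from it. *)
have key (D' : {set T}) : conn adj D' -> [disjoint D' & L :|: Y] ->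
    nbhd adj D' :&: (L :|: Y) = nbhd adj D' :&: L \/
    [/\ #|nbhd adj D' :&: (L :|: Y)| <= 4 * K,
        nbhd adj D' :&: L \subset S & #|nbhd adj D' :&: L| < p].
  move=> cD' d; have dL := disjointWr (subsetUl _ _) d.
  have dY := disjointWr (subsetUr _ _) d.
  case: (component_dichotomy vL cD' dL) => [D'D|[_ nD]]; last first.
    left; apply/setP => z; rewrite !in_setI in_setU; case zN: (z \in nbhd _ _) => //=.
    case zY: (z \in Y); last by rewrite orbF.
    by have := disjointFr nD zN; rewrite (subsetP YD).
  right; have nS : nbhd adj D' :&: L \subset S.
    apply/subsetP => z /setIP[/nbhdP[_ [y yD' zy]] zL]; rewrite in_setI zL andbT.
    apply/nbhdP; split; first by apply/negP => zD; rewrite (disjointFr DL zD) in zL.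
    by exists y => //; apply: (subsetP D'D).
  have dY' z : z \in D' -> z \notin hit :|: [set v] :|: Z.
    move=> zD'; apply/negP => h; have := disjointFr dY zD'.
    by rewrite in_setI h (subsetP D'D).
  have dh : [disjoint D' & hit].
    rewrite disjoint_subset; apply/subsetP => z /dY'.
    by rewrite !in_setU !negb_or => /andP[/andP[]].
  split=> //; last first.
    apply: leq_ltn_trans (hitP D' D'D cD' dh); apply/subset_leq_card.
    by rewrite subsetI nS subsetIl.
  (* [D'] lies in [D] and off both [L] and [Y], hence avoids [S] and the rest of [W :|: Z]. *)
  have dWZ : [disjoint D' & W :|: Z].
    rewrite disjoint_subset; apply/subsetP => z zD'; move: (dY' z zD').
    have zS : (z \in S) = false by rewrite in_setI (disjointFr dL zD') andbF.
    by rewrite [z \in [predC _]]inE /W !in_setU zS.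
  apply: leq_trans (hZ D' cD' dWZ); apply/subset_leq_card/subsetP => z.
  rewrite !in_setI => /andP[zN]; rewrite zN in_setU /= => /orP[zL|zY].
    by rewrite !in_setU (subsetP nS) // in_setI zN.
  by move: zY; rewrite in_setI !in_setU => /andP[/orP[/orP[->|->]|->] _]; rewrite ?orbT.
have imL (A : {set T}) : A \subset L -> f' @: A = f @: A.
  by move=> /subsetP AL; apply: eq_in_imset => z /AL; apply: f'L.
split.
- exact: ElimS (pp_elim P) vU QX SQ fS.
- by rewrite subUset sub1set in_setU vY orbT (subset_trans (pp_names P)) ?subsetUl.
- move=> z; rewrite in_setU => /orP[zL|zY]; last by rewrite f'Y ?setU11.
  by rewrite f'L // setU1r // (pp_name P).
- move=> y z yLY zLY yz; case/setUP: (yLY) => [yL|yY]; last exact: new_edge.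
  case/setUP: (zLY) => [zL|zY]; last first.
    have [|R RX] := new_edge z y zY yLY _; first by rewrite adj_sym.
    by rewrite andbC; exists R.
  have [R RX fR] := pp_edge P yL zL yz.
  by exists R; rewrite ?setU1r // !f'L.
- move=> x; case: (eqVneq x v) => [->|xv].
    apply: leq_trans cY; apply/subset_leq_card/subsetP => z; rewrite inE => /andP[].
    case/setUP => [zL|] //; rewrite f'L // => /eqP fz.
    by have := pp_name P zL; rewrite fz (negPf vU).
  apply: leq_trans (pp_width P x); apply/subset_leq_card/subsetP => z.
  rewrite inE => /andP[/setUP[zL|zY]]; first by rewrite f'L // inE zL.
  by rewrite f'Y // eq_sym (negPf xv).
- move=> D' cD' d; case: (key D' cD' d) => [->|[]//].
  by apply: (pp_small P) => //; apply: disjointWr d; apply: subsetUl.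
- move=> D' cD' d; have dL := disjointWr (subsetUl _ _) d.
  case: (key D' cD' d) => [->|[_ nS np]].
    rewrite imL ?subsetIr //; have [c [R RX h]] := pp_bag P cD' dL.
    by split=> //; exists R; rewrite // setU1r.
  (* All vertices of the new part carry the single name [v]. *)
  have sub : f' @: (nbhd adj D' :&: (L :|: Y)) \subset v |: f @: (nbhd adj D' :&: L).
    apply/subsetP => _ /imsetP[z /setIP[zN /setUP[zL|zY]] ->].
      by rewrite f'L // setU1r // imset_f // in_setI zN.
    by rewrite f'Y // setU11.
  split.
    apply: leq_trans (subset_leq_card sub) _; rewrite cardsU1.
    exact: leq_trans (leq_add (leq_b1 _) (leq_imset_card _ _)) np.
  exists (v |: f @: S); first exact: setU11.
  by apply: subset_trans sub _; apply/setUS/imsetS.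
Qed.

Lemma partial_partition_total L f U X : partial_partition L f U X ->
  exists f' U' X', partial_partition [set: T] f' U' X'.
Proof.
have [n] := ubnP #|~: L|; elim: n L f U X => // n IH L f U X ltL P.
have [L0|/set0Pn[v vL]] := eqVneq (~: L) set0.
  by exists f, U, X; rewrite -setC0 -L0 setCK.
have [|L' [f' [U' [X' [lt P']]]]] := partial_partition_step P (v := v).
  by rewrite -in_setC.
by apply: IH P'; apply: leq_trans lt _; rewrite -ltnS.
Qed.

Lemma tree_partition : tpw_le p adj part_bound.
Proof.
have [|f [U [X P]]] := @partial_partition_total set0 (fun v => v) set0 [set set0].
  split=> [|||v w|x|D _ _|D _ _]; rewrite ?inE ?setI0 ?imset0 ?cards0 ?sub0set //.
  - exact: Elim0.
  - by rewrite (_ : [set _ in _ | _] = set0) ?cards0 //; apply/setP => z; rewrite !inE.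
  - by split=> //; exists set0; rewrite ?inE ?sub0set.
have [X' XX' eX'] := elimination_total (pp_elim P).
(* Vertices of [T] that name no part index empty classes. *)
exists T, (cobag X'), f; split; first exact: cobag_simple.
split; first exact: cobag_tw.
split=> [v w vw|x].
  have [Q QX fQ] := pp_edge P (in_setT v) (in_setT w) vw.
  case: (eqVneq (f v) (f w)) => [|ne]; [by left|right].
  by rewrite /cobag ne; apply/exists_inP; exists Q => //; apply: (subsetP XX').
apply: leq_trans (pp_width P x); apply/subset_leq_card/subsetP => z.
by rewrite !inE.
Qed.

End Construction.

(** * Numerical estimates and conclusion *)

Lemma part_bound_quadratic k p (E : finType) : 2 <= k ->
  part_bound k.+1 p E <= (32 * density p E + 24) * k ^ 2.
Proof.
rewrite /part_bound => k2; move: (density p E) => c.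
(* With [K = k.+1], the terms without [c] add up to [10 * k + 12], which is at most [24 * k ^ 2] for
   [k >= 2]. *)
have kk : 2 * k <= k ^ 2 by rewrite -mulnn leq_mul2r k2 orbT.
have K2 : k.+1 * k.+1 <= 4 * k ^ 2 by move: kk; rewrite -mulnn; lia.
rewrite mulnDl [(c * (4 * k.+1)).+1 * _]mulSn.
have -> : c * (4 * k.+1) * k.+1 = 4 * (c * (k.+1 * k.+1)) by lia.
have -> : 32 * c * k ^ 2 = 8 * (c * (4 * k ^ 2)) by lia.
have := leq_mul (leqnn c) K2; move: kk k2.
by move: (c * (k.+1 * k.+1)) (c * (4 * k ^ 2)) (k ^ 2); clear; lia.
Qed.

Theorem theorem6p1 :
  forall (p : nat) (E : finType) (src tgt : E -> 'I_p),
    loopless_multigraph src tgt ->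
    exists C : R,
      forall (T : finType) (adj : rel T) (k : nat),
        simple_graph adj ->
        topological_minor_free adj src tgt ->
        treewidth_is adj k -> 2 <= k ->
        exists w : nat, tpw_le p adj w /\
          (INR w <= C * INR k ^ 2 * ln (INR k))%R.
Proof.
move=> p E src tgt loopless.
(* The factor 2 compensates for [ln k], which is at least [1 / 2] when [k >= 2]. *)
exists (2 * INR (32 * density p E + 24))%R => T adj k simple free [[I [tr [B [dec small]]]] _] k2.
have [p0|p_gt0] := posnP p.
  (* For [p = 0] there are no edges either, and every graph contains the empty multigraph. *)
  have no : 'I_p -> False by rewrite p0 => -[].
  case: free; exists (fun x => False_rect T (no x)), (fun _ => [::]).
  split; first by move=> x; case: (no x).
  by split=> [e|]; [case: (no (src e))|split=> // e; case: (no (src e))].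
exists (part_bound k.+1 p E); split; first exact: tree_partition simple dec small loopless p_gt0 free.
have /leP/le_INR := part_bound_quadratic p E k2.
rewrite -multE mult_INR; set c := INR (32 * _ + _) => H.
have c0 : (0 <= c)%R by apply: pos_INR.
have k2R : (2 <= INR k)%R by apply: (le_INR 2); apply/leP.
have -> : (INR k ^ 2)%R = INR (k ^ 2) by rewrite /= expnS expn1 -multE mult_INR; ring.
have lnk : (1 / 2 <= ln (INR k))%R.
  apply: Rle_trans (_ : ln 2 <= _)%R; first by have := ln_lt_2; lra.
  case: k2R => [k2R|<-]; last exact: Rle_refl.
  by apply/Rlt_le/ln_increasing => //; lra.
apply: Rle_trans H _.
have : (0 <= c * INR (k ^ 2))%R by apply: Rmult_le_pos => //; apply: pos_INR.
nra.
Qed.
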